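(* Let $\mathcal{A}=\{A_1,\ldots,A_n\}$ be a finite family of real $2\times2$ Vandergraft matrices with extended family $$\mathcal{A}_1=\mathcal{A}\cup\{A_iA_j : A_i,A_j\in\mathcal{A},\ \det A_i<0,\ \det A_j<0,\ A_iA_j\neq cI\}.$$ Assume that all elements of $\mathcal{A}_1$ are Vandergraft matrices; that there are exactly two dominant eigenlines corresponding to non-diagonalizable matrices in $\mathcal{A}_1$, and all non-diagonalizable matrices in $\mathcal{A}_1$ (if more than one) corresponding to the same dominant eigenline have the same orientation; and that the dominant eigenlines of matrices in $\mathcal{A}_1$ are separated from the non-dominant ones. Let $B_1,B_2\in\mathcal{A}_1$ be non-diagonalizable with non-collinear dominant eigenvectors $u_1,u_2$ respectively, where the direction of $u_1$ is chosen arbitrarily and the direction of $u_2$ is chosen so that $u_2$ is positively associated with $u_1$ relative to $B_1$, and suppose that $u_1$ is positively associated with $u_2$ relative to $B_2$. Let $\mathcal{K}=\operatorname{Cone}\{u_1,u_2\}$. Then the only possible $\mathcal{A}$-invariant proper cones are $\pm\mathcal{K}$. These cones are indeed $\mathcal{A}$-invariant if and only if: (a) all non-diagonalizable matrices in $\mathcal{A}$ (if any) with a dominant eigenvector $u_j$ have the same orientation as $B_j$ ($j=1,2$); (b) for all (non-scalar) matrices $A_j\in\mathcal{A}$, their dominant eigenvectors lie in $\mathcal{K}\cup(-\mathcal{K})$ while the non-dominant ones lie outside the interior of $\mathcal{K}\cup(-\mathcal{K})$; (c) for $A=A_j\in\mathcal{A}$ with the eigenvalues $\lambda_{1j}>0$,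 $\lambda_{2j}<0$ and the dominant eigenvector $u_1+\xi u_2\in\mathcal{K}$, the non-dominant eigenvector must be collinear with $u_1+\eta u_2$, where $$\frac{\lambda_{1j}}{\lambda_{2j}}\le\frac{\eta}{\xi}\le\frac{\lambda_{2j}}{\lambda_{1j}}.$$
   Context: All matrices are real. A set $\mathcal{K}\subseteq\mathbb{R}^n$ is a cone if $a\mathcal{K}\subseteq\mathcal{K}$ for all $a\ge 0$; a cone is proper if it is convex ($\mathcal{K}+\mathcal{K}\subseteq\mathcal{K}$), closed, pointed ($\mathcal{K}\cap-\mathcal{K}=\{0\}$) and solid (nonempty interior). $\mathcal{K}$ is $A$-invariant if $Ax\in\mathcal{K}$ for all $x\in\mathcal{K}$, and $\mathcal{A}$-invariant if it is $A$-invariant for every $A\in\mathcal{A}$. $\operatorname{Cone}X$ is the set of all finite linear combinations of elements of $X$ with non-negative coefficients. In the definition of $\mathcal{A}_1$, products equal to scalar multiples $cI$ of the identity are omitted, and $i=j$ is allowed. A real $n\times n$ matrix $A$ is a Vandergraft matrix if (1) its spectral radius $\rho(A)$ is an eigenvalue of $A$, and (2) $\deg\rho(A)\ge\deg\lambda$ for every eigenvalue $\lambda$ with $|\lambda|=\rho(A)$, where $\deg\lambda$ is the multiplicity of $\lambda$ as a root of the minimal polynomial of $A$. For a $2\times 2$ Vandergraft matrix that is not a scalar multiple of $I$, the (one-dimensional) eigenspace for $\rho(A)$ is its dominant eigenline and the nonzero vectors in it are dominant eigenvectors; if $A$ has a second eigenvalue different from $\rho(A)$, the corresponding eigenspace is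 its non-dominant eigenline, with non-dominant eigenvectors the nonzero vectors in it. Scalar matrices contribute no eigenlines. If $A\in\mathbb{R}^{2\times2}$ is a non-diagonalizable Vandergraft matrix with eigenvalue $\lambda$ and eigenvector $u$, then every $v\in\mathbb{R}^2$ satisfies $Av=\lambda v+xu$ for a unique $x\in\mathbb{R}$; $v$ is positively (negatively) associated with $u$ relative to $A$ if $x>0$ ($x<0$). Non-diagonalizable matrices sharing the eigenvector $u$ have the same orientation if the sets of vectors positively associated with $u$ relative to these matrices coincide. The dominant eigenlines of matrices in $\mathcal{A}_1$ are separated from the non-dominant ones if there exist linearly independent vectors $v_1,v_2\in\mathbb{R}^2$ such that the interior of $\operatorname{Cone}\{v_1,v_2\}$ is free of the non-dominant eigenvectors of matrices in $\mathcal{A}_1$, while the interior of $\operatorname{Cone}\{v_1,-v_2\}$ is free of the dominant eigenvectors of non-scalar matrices in $\mathcal{A}_1$; the vectors $v_j$ themselves are allowed to be both dominant and non-dominant eigenvectors, but only if as the latter they correspond to matrices in $\mathcal{A}_1$ with non-negative determinants.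
   Formalization: In (c), the dominant eigenvector of A_j is required to be u_1+ξu_2 in K with ξ≠0, rather than this being a premise: with dominant eigenvector u_2 the condition would be vacuous and the ''if'' part false, and for ξ=0 the ratio η/ξ is undefined. *)

(* Defs.v *)
(* MathComp with MathComp-Analysis; the complex numbers over R are R[i] of
   mathcomp-real-closed. *)
From HB Require Import structures.
From mathcomp Require Import all_boot all_order all_algebra.
From mathcomp Require Import all_classical all_reals all_analysis.
From mathcomp Require Import complex.

Set Implicit Arguments.
Unset Strict Implicit.
Unset Printing Implicit Defensive.

Import Order.TTheory GRing.Theory Num.Theory.
Import numFieldNormedType.Exports.

Local Open Scope classical_set_scope.
Local Open Scope ring_scope.

Definition setN (V : zmodType) (K : set V) : set V := [set - x | x in K].

Definition is_cone (R : realType) (n : nat) (K : set 'cV[R]_n) : Prop :=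
  forall (a : R) (x : 'cV[R]_n), 0 <= a -> K x -> K (a *: x).

Definition proper_cone (R : realType) (n : nat) (K : set 'cV[R]_n) : Prop :=
  [/\ is_cone K,
      forall x y, K x -> K y -> K (x + y),
      closed K,
      K `&` setN K = [set 0] &
      interior K !=set0].

Definition mx_invariant (R : realType) (n : nat)
    (A : 'M[R]_n) (K : set 'cV[R]_n) : Prop :=
  forall x, K x -> K (A *m x).

Definition family_invariant (R : realType) (n : nat)
    (F : set 'M[R]_n) (K : set 'cV[R]_n) : Prop :=
  forall A, F A -> mx_invariant A K.

Definition Cone (R : realType) (n : nat) (X : set 'cV[R]_n) : set 'cV[R]_n :=
  [set x | exists (k : nat) (c : 'I_k -> R) (v : 'I_k -> 'cV[R]_n),
     [/\ forall i, 0 <= c i, forall i, X (v i) & x = \sum_i c i *: v i]].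

(* [eigenvalue] is defined in the library through row vectors; the eigenvalues
   are the same for column vectors, which are used for eigenvectors below. *)
Definition complex_eigenvalue (R : realType) (n : nat)
    (A : 'M[R]_n) (z : R[i]) : Prop :=
  eigenvalue (map_mx (real_complex R) A) z.

Definition spectral_radius (R : realType) (n : nat) (A : 'M[R]_n) : R :=
  sup [set ComplexField.Normc.normc z | z in complex_eigenvalue A].

Definition eigenvalue_degree (R : realType) (n : nat)
    (A : 'M[R]_n.+1) (z : R[i]) : nat :=
  mup z (map_poly (real_complex R) (mxminpoly A)).

Definition vandergraft (R : realType) (n : nat) (A : 'M[R]_n.+1) : Prop :=
  eigenvalue A (spectral_radius A) /\
  forall z : R[i], complex_eigenvalue A z ->
    ComplexField.Normc.normc z = spectral_radius A ->
    (eigenvalue_degree A z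
       <= eigenvalue_degree A (real_complex R (spectral_radius A)))%N.

Definition eigenvector (R : realType) (n : nat)
    (A : 'M[R]_n) (l : R) (v : 'cV[R]_n) : Prop :=
  v != 0 /\ A *m v = l *: v.

(* The dominant and non-dominant notions are meaningful for Vandergraft
   matrices. *)
Definition dominant_eigenline (R : realType) (A : 'M[R]_2) : set 'cV[R]_2 :=
  [set v | A *m v = spectral_radius A *: v].

Definition dominant_eigenvector (R : realType)
    (A : 'M[R]_2) (v : 'cV[R]_2) : Prop :=
  ~~ is_scalar_mx A /\ eigenvector A (spectral_radius A) v.

Definition nondominant_eigenvector (R : realType)
    (A : 'M[R]_2) (v : 'cV[R]_2) : Prop :=
  ~~ is_scalar_mx A /\
  exists2 l : R, l != spectral_radius A & eigenvector A l v.

(* Used when [A] is a non-diagonalizable Vandergraft matrix and [u] is nonzero: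
   [l] is then the only eigenvalue of [A]. *)
Definition positively_associated (R : realType)
    (A : 'M[R]_2) (u v : 'cV[R]_2) : Prop :=
  exists l x : R, [/\ A *m u = l *: u, 0 < x & A *m v = l *: v + x *: u].

Definition same_orientation (R : realType)
    (u : 'cV[R]_2) (A B : 'M[R]_2) : Prop :=
  [set v | positively_associated A u v] = [set v | positively_associated B u v].

Definition extended_family (R : realType) (F : set 'M[R]_2) : set 'M[R]_2 :=
  F `|` [set M | exists A B : 'M[R]_2,
           [/\ F A /\ F B, \det A < 0, \det B < 0,
               M = A *m B & ~~ is_scalar_mx M]].

(* A vector [v1] or [v2] may be dominant for one matrix of [F1] and
   non-dominant for another one only if the latter has a non-negative
   determinant. *)
Definition eigenlines_separated (R : realType) (F1 : set 'M[R]_2) : Prop :=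
  exists v1 v2 : 'cV[R]_2,
    [/\ free [:: v1; v2],
        forall M v, F1 M -> nondominant_eigenvector M v ->
          ~ interior (Cone [set v1; v2]) v,
        forall M v, F1 M -> dominant_eigenvector M v ->
          ~ interior (Cone [set v1; - v2]) v &
        forall v M N, v = v1 \/ v = v2 -> F1 M -> F1 N ->
          dominant_eigenvector M v -> nondominant_eigenvector N v ->
          0 <= \det N].

Definition exactly_two_nondiag_eigenlines (R : realType)
    (F1 : set 'M[R]_2) : Prop :=
  ([set dominant_eigenline M | M in F1 `&` [set M | ~ diagonalizable M]]
     #= `I_2)%card.

Definition oriented_family (R : realType) (F1 : set 'M[R]_2) : Prop :=
  forall M N u, F1 M -> F1 N -> ~ diagonalizable M -> ~ diagonalizable N ->
    dominant_eigenvector M u -> dominant_eigenvector N u ->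
    same_orientation u M N.

(* Main.v *)
(* In the basis [u1], [u2] the matrix [A] becomes [[a, b], [c, d]], and [K] is
   [A]-invariant iff these four entries are non-negative.
   Uniqueness: the powers of [B1] turn every vector off the line of [u1] towards
   [u1] or [- u1], according to the sign of its [u2]-coordinate, so a closed
   invariant cone with interior contains one of these two rays and lies on one
   side of that line; likewise for [B2].
   Necessity of (a)-(c) is elementary Perron-Frobenius theory for non-negative
   2 x 2 matrices.
   Sufficiency: a non-scalar [A] with a double eigenvalue is non-diagonalizable,
   so its eigenline is that of [u1] or [u2] and (a) makes it triangular with
   non-negative entries. If the eigenvalues [r > m] are distinct, the entries
   are explicit functions of [r], [m] and the eigenvectors; (b) makes them
   non-negative if [0 <= m], and (c) does if [m < 0]. *)
Require Import Defs.
From HB Require Import structures.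
From mathcomp Require Import all_boot all_order all_algebra.
From mathcomp Require Import all_classical all_reals all_analysis.
From mathcomp Require Import complex.
From mathcomp Require Import ring lra.

Set Implicit Arguments.
Unset Strict Implicit.
Unset Printing Implicit Defensive.

Import Order.TTheory GRing.Theory Num.Theory.
Import numFieldNormedType.Exports.

Local Open Scope classical_set_scope.
Local Open Scope ring_scope.

(** * Eigenvalues, diagonalizability and the spectral radius *)

(** [A - l] and its transpose are invertible together; this links the row eigenvectors behind
    [eigenvalue] to column eigenvectors. *)
Lemma eigenvalue_trmx (F : fieldType) (n : nat) (A : 'M[F]_n) (l : F) :
  eigenvalue A^T l = eigenvalue A l.
Proof.
by rewrite /eigenvalue /eigenspace !kermx_eq0 !row_free_unit -unitmx_tr
  linearB /= trmxK tr_scalar_mx.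
Qed.

Lemma eigenvalue_eigenvector (R : realType) (n : nat) (A : 'M[R]_n) (l : R) :
  eigenvalue A l <-> exists v, eigenvector A l v.
Proof.
rewrite -eigenvalue_trmx; split=> [/eigenvalueP[v vA v0]|[v [v0 Av]]].
  exists v^T; split; first by rewrite trmx_eq0.
  by apply: trmx_inj; rewrite trmx_mul trmxK vA linearZ /= trmxK.
apply/eigenvalueP; exists v^T; last by rewrite trmx_eq0.
by rewrite -trmx_mul Av linearZ.
Qed.

(** The characteristic polynomial is a product of distinct linear factors, and the minimal
    polynomial divides it. *)
Lemma diagonalizable_uniq_eigenvalues (F : fieldType) (n : nat)
    (A : 'M[F]_n.+1) (s : seq F) :
  size s = n.+1 -> uniq s -> all (eigenvalue A) s -> diagonalizable A.
Proof.
move=> ss us evs; apply/diagonalizableP; exists s => //.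
rewrite -[X in _ %| X]scale1r -(eqP (char_poly_monic A)).
rewrite -(all_roots_prod_XsubC (rs := s)) ?mxminpoly_dvd_char //.
- by rewrite size_char_poly ss.
- by apply: sub_all evs => l; rewrite eigenvalue_root_char.
- by rewrite uniq_rootsE.
Qed.

Lemma diagonalizable_one_eigenvalue (F : fieldType) (n : nat)
    (A : 'M[F]_n) (l : F) :
  diagonalizable A -> (forall m, eigenvalue A m -> m = l) -> A = l%:M.
Proof.
move=> [P Pu /(similar_diagLR Pu)[d dE]] evl.
suff dl : diag_mx d = l%:M.
  by rewrite dE dl conjVmx // mul_mx_scalar -scalemxAl mulVmx // scalemx1.
rewrite -diag_const_mx; congr diag_mx; apply/rowP => i; rewrite mxE.
(* Row [i] of the invertible [P] is an eigenvector for the [i]-th diagonal entry. *)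
apply: evl; apply/eigenvalueP; exists (row i P); last first.
  apply: contraTneq Pu => Pi0; rewrite unitmxE unitfE negbK.
  by rewrite (expand_det_row _ i) big1 // => j _;
     move/rowP: Pi0 => /(_ j); rewrite !mxE => ->; rewrite mul0r.
rewrite -row_mul dE conjVmx // !mulmxA mulmxV // mul1mx.
by rewrite row_mul row_diag_mx -scalemxAl -rowE.
Qed.

Lemma normc_ge0 (R : rcfType) (z : R[i]) : 0 <= ComplexField.Normc.normc z.
Proof. by case: z => a b; exact: sqrtr_ge0. Qed.

(** Without a bound the supremum defining the spectral radius would carry no information. The sum of
    the moduli of all roots of the characteristic polynomial is one. *)
Lemma complex_eigenvalue_ubound (R : realType) (n : nat) (A : 'M[R]_n) :
  has_ubound [set ComplexField.Normc.normc z | z in complex_eigenvalue A].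
Proof.
have [s sE] := closed_field_poly_normal (char_poly (map_mx (real_complex R) A)).
rewrite (eqP (char_poly_monic _)) scale1r in sE.
exists (\sum_(z <- s) ComplexField.Normc.normc z).
move=> _ [z + <-]; rewrite /complex_eigenvalue /= eigenvalue_root_char sE => zP.
have zs : z \in s by rewrite -root_prod_XsubC.
have [i t rt] := rot_to zs.
rewrite -(perm_big _ (permEl (perm_rot i s))) rt big_cons lerDl.
by apply: sumr_ge0 => y _; exact: normc_ge0.
Qed.

Lemma normc_real_complex (R : rcfType) (l : R) :
  ComplexField.Normc.normc (real_complex R l) = `|l|.
Proof. by rewrite /= expr0n addr0 sqrtr_sqr. Qed.

Lemma eigenvalue_le_spectral_radius (R : realType) (n : nat) (A : 'M[R]_n)
    (l : R) : eigenvalue A l -> `|l| <= spectral_radius A.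
Proof.
move=> evl; apply: (ub_le_sup (complex_eigenvalue_ubound A)).
exists (real_complex R l); last exact: normc_real_complex.
by rewrite /complex_eigenvalue eigenvalue_map.
Qed.

Lemma vandergraft_spectral_radius (R : realType) (n : nat) (A : 'M[R]_n.+1) :
  vandergraft A ->
  [/\ eigenvalue A (spectral_radius A), 0 <= spectral_radius A &
      forall l, eigenvalue A l -> `|l| <= spectral_radius A].
Proof.
move=> [ev _]; split => //.
  exact: le_trans (normr_ge0 _) (eigenvalue_le_spectral_radius ev).
by move=> l; exact: eigenvalue_le_spectral_radius.
Qed.

(** * Perturbations, interiors and continuity of linear forms *)

Lemma perturb_cvg (R : realType) (V : normedModType R) (v w : V) :
  (v + k.+1%:R^-1 *: w) @[k --> \oo] --> v.
Proof.
rewrite -[X in _ --> X]addr0; apply: cvgD; first exact: cvg_cst.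
by rewrite -[X in _ --> X](scale0r w); apply: cvgZr_tmp; exact: cvg_harmonic.
Qed.

Lemma linear_form_continuous (R : realType) (n : nat)
    (f : {linear 'cV[R]_n -> R^o}) :
  continuous (f : _ -> R).
Proof.
have fE v : f v = \sum_(i < n) v i 0 * f (delta_mx i 0).
  rewrite [in LHS](matrix_sum_delta v) linear_sum; apply: eq_bigr => i _.
  by rewrite big_ord1 linearZ.
rewrite (_ : f = (fun v => \sum_(i < n) v i 0 * f (delta_mx i 0)) :> (_ -> R));
  last exact/funext.
elim: (index_enum 'I_n) => [|i s IHs] v.
  under [X in continuous_at _ X]eq_fun do rewrite big_nil;
    exact: cst_continuous.
under [X in continuous_at _ X]eq_fun do rewrite big_cons.
by apply: cvgD (IHs v); apply: cvgM; [exact: coord_continuous|exact: cvg_cst].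
Qed.

Lemma interior_perturb (R : realType) (V : normedModType R) (X : set V) (v w :
  V) :
  interior X v -> exists2 t : R, 0 < t & X (v + t *: w).
Proof.
move=> /(@perturb_cvg _ _ v w)[k _ /(_ k (leqnn k)) Xk].
by exists k.+1%:R^-1; rewrite ?invr_gt0.
Qed.

Lemma closed_perturb (R : realType) (V : normedModType R) (X : set V) (v w : V)
  :
  closed X -> (forall k, X (v + k.+1%:R^-1 *: w)) -> X v.
Proof. by move=> cX Xk; apply: (closed_cvg X cX _ _ (@perturb_cvg _ _ v w));
  exact: nearW. Qed.

(** * Coordinates in the plane and cones with two generators *)

Lemma free_comb (R : realType) (u1 u2 v : 'cV[R]_2) :
  free [:: u1; u2] -> exists a b, v = a *: u1 + b *: u2.
Proof.
move=> fr; pose X := [tuple u1; u2].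
have bX : basis_of fullv X.
  by rewrite basisEfree fr subvf dimvf dim_matrix.
exists (coord X ord0 v), (coord X (lift ord0 ord0) v).
by rewrite {1}(coord_basis bX (memvf v)) !big_ord_recl big_ord0 addr0.
Qed.

Lemma coord_comb (R : realType) (u1 u2 : 'cV[R]_2) (a b : R) :
  free [:: u1; u2] ->
  coord [tuple u1; u2] ord0 (a *: u1 + b *: u2) = a /\
  coord [tuple u1; u2] ord_max (a *: u1 + b *: u2) = b.
Proof.
move=> fr; pose X := [tuple u1; u2]; rewrite !linearD !linearZ /=.
have e i j := @coord_free _ _ _ X i j fr.
have /= -> := e ord0 ord0; have /= -> := e ord0 ord_max.
have /= -> := e ord_max ord0; have /= -> := e ord_max ord_max.
by rewrite !mulr0 !mulr1 addr0 add0r.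
Qed.

Lemma comb_inj (R : realType) (u1 u2 : 'cV[R]_2) (a b c d : R) :
  free [:: u1; u2] -> a *: u1 + b *: u2 = c *: u1 + d *: u2 -> a = c /\ b = d.
Proof.
move=> fr e; have [a1 b1] := coord_comb a b fr.
have [c1 d1] := coord_comb c d fr.
by split; [rewrite -[LHS]a1 e|rewrite -[LHS]b1 e].
Qed.

(** Coefficients of equal generators add up, so one coefficient per generator suffices. *)
Lemma Cone2 (R : realType) (n : nat) (u1 u2 v : 'cV[R]_n) :
  Cone [set u1; u2] v <->
  exists a b, [/\ 0 <= a, 0 <= b & v = a *: u1 + b *: u2].
Proof.
split=> [[k [c [w [c0 wu ->]]]]|[a [b [a0 b0 ->]]]].
  elim/big_ind: _ => [|_ _ [a [b [a0 b0 ->]]] [a' [b' [a'0 b'0 ->]]]|i _].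
  - by exists 0, 0; rewrite !scale0r addr0.
  - by exists (a + a'), (b + b'); rewrite !addr_ge0 // !scalerDl addrACA.
  - by case: (wu i) => ->; [exists (c i), 0|exists 0, (c i)];
      rewrite c0 scale0r ?addr0 ?add0r.
exists 2%N, (fun i => if i == 0 then a else b), (fun i => if i == 0 then u1
  else u2).
split; last by rewrite big_ord_recl big_ord1.
  by move=> i; case: ifP.
by move=> i; case: ifP => _; [left|right].
Qed.

Lemma Cone2_comb (R : realType) (u1 u2 : 'cV[R]_2) (a b : R) :
  free [:: u1; u2] ->
  Cone [set u1; u2] (a *: u1 + b *: u2) <-> 0 <= a /\ 0 <= b.
Proof.
move=> fr; rewrite Cone2; split=> [[c [d [c0 d0 e]]]|[a0 b0]];
  last by exists a, b.
by have [-> ->] := comb_inj fr e.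
Qed.

Lemma setN_Cone2 (R : realType) (u1 u2 : 'cV[R]_2) (a b : R) :
  free [:: u1; u2] ->
  setN (Cone [set u1; u2]) (a *: u1 + b *: u2) <-> a <= 0 /\ b <= 0.
Proof.
move=> fr; rewrite -[a <= 0]oppr_ge0 -[b <= 0]oppr_ge0 -(Cone2_comb _ _ fr).
by rewrite !scaleNr -opprD; split=> [[v Kv <-]|];
  [rewrite opprK|exists (- (a *: u1 + b *: u2)); rewrite ?opprK].
Qed.

(** The double cone is a pair of opposite closed quadrants. The product form is insensitive to
    rescaling, as suits eigenvectors. *)
Lemma double_Cone2 (R : realType) (u1 u2 : 'cV[R]_2) (a b : R) :
  free [:: u1; u2] ->
  (Cone [set u1; u2] `|` setN (Cone [set u1; u2])) (a *: u1 + b *: u2) <->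
  0 <= a * b.
Proof.
move=> fr; split=> [[/(Cone2_comb _ _ fr)|/(setN_Cone2 _ _ fr)] [a0 b0]|ab].
- exact: mulr_ge0.
- exact: mulr_le0.
have [a0|a0] := leP 0 a; have [b0|b0] := leP 0 b.
- by left; apply/Cone2_comb.
- have -> : a = 0 by nra.
  by right; apply/setN_Cone2 => //; rewrite lexx ltW.
- have -> : b = 0 by nra.
  by right; apply/setN_Cone2 => //; rewrite lexx ltW.
- by right; apply/setN_Cone2 => //; rewrite !ltW.
Qed.

Lemma interior_double_Cone2 (R : realType) (u1 u2 : 'cV[R]_2) (a b : R) :
  free [:: u1; u2] ->
  interior (Cone [set u1; u2] `|` setN (Cone [set u1; u2]))
    (a *: u1 + b *: u2) <-> 0 < a * b.
Proof.
move=> fr; split=> [iv|ab].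
  have pert c d : exists2 t : R, 0 < t & 0 <= (a + t * c) * (b + t * d).
    have [t t0 Kt] := interior_perturb (c *: u1 + d *: u2) iv.
    exists t => //; apply/(double_Cone2 _ _ fr); move: Kt.
    by rewrite scalerDr !scalerA addrACA -!scalerDl.
  have /(double_Cone2 _ _ fr) := interior_subset iv.
  (* On a coordinate axis, a push into an adjacent quadrant of opposite signs leaves the double
     cone. *)
  rewrite le_eqVlt => /orP[|//]; rewrite eq_sym mulf_eq0 => /orP[]/eqP z.
    have [b0|b0] := leP 0 b.
      by have [t t0] := pert (-1) 1; nra.
    by have [t t0] := pert 1 (-1); nra.
  have [a0|a0] := leP 0 a.
    by have [t t0] := pert 1 (-1); nra.
  by have [t t0] := pert (-1) 1; nra.
(* Conversely, the product of the two coordinates is continuous, so it stays positive near the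
   point. *)
pose f v := coord [tuple u1; u2] ord0 v * coord [tuple u1; u2] ord_max v.
have fE c d : f (c *: u1 + d *: u2) = c * d.
  by rewrite /f; have [-> ->] := coord_comb c d fr.
have cc i : continuous (coord [tuple u1; u2] i : _ -> R).
  exact: linear_form_continuous.
have fc : continuous f by move=> v; exact: cvgM (cc ord0 v) (cc ord_max v).
have := cvgr_gt _ (fc (a *: u1 + b *: u2)); rewrite fE => /(_ _ _ ab).
apply: filterS => v; have [c [d ->]] := free_comb v fr.
by rewrite fE => /ltW /(double_Cone2 _ _ fr).
Qed.

(** * Invariance, eigenvectors and eigenvalues in coordinates *)

Lemma mulmx_comb (R : realType) (A : 'M[R]_2) (u1 u2 : 'cV[R]_2)
    (a b c d x y : R) :
  A *m u1 = a *: u1 + c *: u2 -> A *m u2 = b *: u1 + d *: u2 ->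
  A *m (x *: u1 + y *: u2) = (a * x + b * y) *: u1 + (c * x + d * y) *: u2.
Proof.
move=> A1 A2; rewrite mulmxDr -!scalemxAr A1 A2 !scalerDr !scalerA addrACA.
by rewrite -!scalerDl ![x * _]mulrC ![y * _]mulrC.
Qed.

Lemma Cone2_invariant (R : realType) (A : 'M[R]_2) (u1 u2 : 'cV[R]_2)
    (a b c d : R) :
  free [:: u1; u2] ->
  A *m u1 = a *: u1 + c *: u2 -> A *m u2 = b *: u1 + d *: u2 ->
  mx_invariant A (Cone [set u1; u2]) <->
  [/\ 0 <= a, 0 <= b, 0 <= c & 0 <= d].
Proof.
move=> fr A1 A2; split=> [inv|[a0 b0 c0 d0] v].
  have := inv (1 *: u1 + 0 *: u2); have := inv (0 *: u1 + 1 *: u2).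
  rewrite !(mulmx_comb _ _ A1 A2) !Cone2_comb // !mulr0 !mulr1 !addr0 !add0r.
  by rewrite lexx ler01 => -[] // b0 d0 [].
have [x [y ->]] := free_comb v fr;
  rewrite (mulmx_comb _ _ A1 A2) !Cone2_comb //.
by move=> [x0 y0]; rewrite !addr_ge0 ?mulr_ge0.
Qed.

Lemma comb_eq0 (R : realType) (u1 u2 : 'cV[R]_2) (a b : R) :
  free [:: u1; u2] -> (a *: u1 + b *: u2 == 0) = (a == 0) && (b == 0).
Proof.
move=> fr; apply/eqP/andP => [e|[/eqP-> /eqP->]];
  last by rewrite !scale0r addr0.
by have [-> ->] : a = 0 /\ b = 0 by apply: (comb_inj fr);
  rewrite e !scale0r addr0.
Qed.

Lemma eigenvector_comb (R : realType) (A : 'M[R]_2) (u1 u2 : 'cV[R]_2)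
    (a b c d l x y : R) :
  free [:: u1; u2] ->
  A *m u1 = a *: u1 + c *: u2 -> A *m u2 = b *: u1 + d *: u2 ->
  eigenvector A l (x *: u1 + y *: u2) <->
  [/\ (x != 0) || (y != 0), a * x + b * y = l * x & c * x + d * y = l * y].
Proof.
move=> fr A1 A2; rewrite /eigenvector comb_eq0 // negb_and.
rewrite (mulmx_comb _ _ A1 A2) scalerDr !scalerA.
by split=> [[-> /(comb_inj fr)[-> ->]]|[-> -> ->]].
Qed.

Lemma eigenvalue_comb (R : realType) (A : 'M[R]_2) (u1 u2 : 'cV[R]_2)
    (a b c d l : R) :
  free [:: u1; u2] ->
  A *m u1 = a *: u1 + c *: u2 -> A *m u2 = b *: u1 + d *: u2 ->
  eigenvalue A l <-> (a - l) * (d - l) = b * c.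
Proof.
move=> fr A1 A2; rewrite eigenvalue_eigenvector; split=> [[v]|e].
  have [x [y ->]] := free_comb v fr.
  move=> /(eigenvector_comb _ _ _ fr A1 A2)[xy e1 e2].
  (* Multiplying [A - l] by its adjugate shows that the determinant annihilates both coordinates,
     one of which is nonzero. *)
  suff : ((a - l) * (d - l) - b * c) * x = 0 /\ ((a - l) * (d - l) - b * c) * y
    = 0.
    move=> [/eqP + /eqP]; rewrite !mulf_eq0.
    by case/orP: xy => /negbTE->; rewrite orbF // => /eqP; lra.
  split.
    transitivity ((d - l) * (a * x + b * y - l * x) - b * (c * x + d * y - l *
      y)).
      by ring.
    by rewrite e1 e2; ring.
  transitivity ((a - l) * (c * x + d * y - l * y) - c * (a * x + b * y - l *
    x)).
    by ring.
  by rewrite e1 e2; ring.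
have ev x y := (eigenvector_comb l x y fr A1 A2).2.
(* An eigenvector is read off the first row of [A - l] if [b != 0]. If [b = 0], then [u2] serves
   when [a != l]; otherwise the second row gives one when [c != 0], and [u1] serves when [c = 0]. *)
have [b0|b0] := eqVneq b 0; last first.
  by exists (b *: u1 + (l - a) *: u2); apply: ev; rewrite b0; split => //; lra.
have [ad|ad] := eqVneq (a - l) 0; last first.
  by exists (0 *: u1 + 1 *: u2); apply: ev; rewrite oner_eq0 orbT;
    split => //; nra.
have [c0|c0] := eqVneq c 0; last first.
  by exists ((l - d) *: u1 + c *: u2); apply: ev; rewrite c0 orbT;
    split => //; nra.
by exists (1 *: u1 + 0 *: u2); apply: ev; rewrite oner_eq0; split => //; nra.
Qed.

Lemma scalar_comb (R : realType) (A : 'M[R]_2) (u1 u2 : 'cV[R]_2)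
    (a b c d : R) :
  free [:: u1; u2] ->
  A *m u1 = a *: u1 + c *: u2 -> A *m u2 = b *: u1 + d *: u2 ->
  is_scalar_mx A <-> [/\ b = 0, c = 0 & a = d].
Proof.
move=> fr A1 A2; split=> [/is_scalar_mxP[k Ak]|[b0 c0 ad]].
  have : a *: u1 + c *: u2 = k *: u1 + 0 *: u2.
    by rewrite -A1 Ak mul_scalar_mx scale0r addr0.
  have : b *: u1 + d *: u2 = 0 *: u1 + k *: u2.
    by rewrite -A2 Ak mul_scalar_mx scale0r add0r.
  by move=> /(comb_inj fr)[-> ->] /(comb_inj fr)[-> ->].
apply/is_scalar_mxP; exists d; apply/matrixP => i j.
have entry (M : 'M[R]_2) : M i j = (M *m (delta_mx j 0 : 'cV[R]_2)) i 0.
  by rewrite -colE mxE.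
rewrite (entry A) (entry d%:M).
have [x [y ->]] := free_comb (delta_mx j 0 : 'cV[R]_2) fr.
by rewrite (mulmx_comb _ _ A1 A2) mul_scalar_mx scalerDr !scalerA b0 c0 ad
  !mul0r addr0 add0r.
Qed.

(** * Uniqueness of the invariant proper cone *)

(** This makes an invariant cone of the family invariant under [B1] and [B2], which may be
    products. *)
Lemma extended_family_invariant (R : realType) (F : set 'M[R]_2)
    (C : set 'cV[R]_2) :
  family_invariant F C -> family_invariant (extended_family F) C.
Proof.
move=> inv M [/inv //|[A [B [[FA FB] _ _ -> _]]]] v Cv.
by rewrite -mulmxA; exact/(inv A FA)/(inv B FB).
Qed.

(* The powers of [B] map [v] to [l ^ k *: v + k * l ^ k.-1 * b * x *: u], whose
   direction converges to that of [b *: u]. *)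
Lemma proper_cone_associated (R : realType) (B : 'M[R]_2) (C : set 'cV[R]_2)
    (u w : 'cV[R]_2) (l x a b : R) :
  proper_cone C -> mx_invariant B C -> 0 <= l -> 0 < x ->
  B *m u = l *: u -> B *m w = l *: w + x *: u ->
  C (a *: u + b *: w) -> C (b *: u).
Proof.
move=> [cone _ cC _ _] inv l0 x0 Bu Bw; set v := a *: u + b *: w => Cv.
have Bv : B *m v = l *: v + (x * b) *: u.
  rewrite mulmxDr -!scalemxAr Bu Bw !scalerDr !scalerA addrA.
  by rewrite [a * l]mulrC [b * l]mulrC [b * x]mulrC.
(* The vector is [B ^ k.+1 *m v] divided by [l ^ k]. For [l = 0], treated apart, [B *m v] already
   equals [(x * b) *: u]. *)
clearbody v; have Cw k : C (l *: v + k.+1%:R *: ((x * b) *: u)).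
  elim: k => [|k IHk]; first by rewrite scale1r -Bv; exact: inv.
  move: l0; rewrite le_eqVlt => /predU1P[l0|l0].
    have := inv _ Cv; rewrite Bv -l0 !scale0r !add0r; apply: cone; exact: ler0n.
  rewrite (_ : _ + _ = l^-1 *: (B *m (l *: v + k.+1%:R *: ((x * b) *: u)))).
    by apply: cone; [rewrite invr_ge0 ltW|exact: inv].
  rewrite mulmxDr -!scalemxAr Bv Bu; apply: (scalerI (lt0r_neq0 l0)).
  rewrite [RHS]scalerA divff ?gt_eqF // scale1r !scalerDr !scalerA.
  rewrite -addrA -scalerDl; congr (_ + _ *: _).
  by rewrite -[in LHS]natr1; ring.
have Cxb : C ((x * b) *: u).
  apply: (@closed_perturb _ _ _ _ (l *: v)) => // k.
  rewrite (_ : _ + _ = k.+1%:R^-1 *: (l *: v + k.+1%:R *: ((x * b) *: u))).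
    by apply: cone => //; rewrite invr_ge0.
  rewrite scalerDr addrC; congr (_ + _).
  by rewrite [RHS]scalerA mulVf ?pnatr_eq0 // scale1r.
have -> : b *: u = x^-1 *: ((x * b) *: u).
  by rewrite scalerA mulrA mulVf ?mul1r ?gt_eqF.
by apply: cone => //; rewrite invr_ge0 ltW.
Qed.

(** Multiples of opposite signs would place a nonzero vector in both the cone and its negative,
    against pointedness. *)
Lemma proper_cone_ray (R : realType) (n : nat) (C : set 'cV[R]_n)
    (u : 'cV[R]_n) (p q : R) :
  proper_cone C -> u != 0 -> C (p *: u) -> C (q *: u) -> 0 <= p * q.
Proof.
move=> [cone _ _ point _] u0 Cp Cq; rewrite leNgt; apply/negP => pq.
have [p0 q0] : p != 0 /\ q != 0 by split; apply: contraTneq pq => ->;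
  rewrite ?mulr0 ?mul0r ltxx.
have : (C `&` setN C) (p *: u).
  split=> //; exists (- (p *: u)); last by rewrite opprK.
  have -> : - (p *: u) = (- p / q) *: (q *: u)
    by rewrite scalerA divfK // scaleNr.
  by apply: cone => //; rewrite -(pmulr_lge0 _ (_ : 0 < q ^+ 2))
    ?exprn_even_gt0 //; rewrite expr2 mulrA divfK //; lra.
by rewrite point /= => /eqP; rewrite scaler_eq0 (negbTE p0) (negbTE u0).
Qed.

(** One vector of [C] with [b != 0] yields [b *: u1] and [b *: u2], hence a whole quadrant.
    Pointedness on the two axes excludes everything else, and the sign of [b] selects the cone or
    its negative. *)
Lemma proper_cone_eq_Cone2 (R : realType) (C : set 'cV[R]_2)
    (u1 u2 : 'cV[R]_2) :
  free [:: u1; u2] -> proper_cone C ->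
  (forall a b, C (a *: u1 + b *: u2) -> C (b *: u1)) ->
  (forall a b, C (a *: u1 + b *: u2) -> C (a *: u2)) ->
  C = Cone [set u1; u2] \/ C = setN (Cone [set u1; u2]).
Proof.
move=> fr pC C1 C2; have [cone add _ _ [v0 iv0]] := pC.
have [u10 u20] : u1 != 0 /\ u2 != 0.
  have := comb_eq0 1 0 fr; have := comb_eq0 0 1 fr.
  by rewrite !scale0r !scale1r addr0 add0r oner_eq0 andbF andFb => -> ->.
have [a [b [Cv b0]]] : exists a b, C (a *: u1 + b *: u2) /\ b != 0.
  (* An interior point on the line of [u1] is pushed off it along [u2]. *)
  have [t t0 Ct] := interior_perturb u2 iv0.
  have Cv0 := interior_subset iv0.
  have [a [b v0E]] := free_comb v0 fr; rewrite v0E in Ct Cv0.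
  have [b0|b0] := eqVneq b 0; last by exists a, b.
  by exists a, t; move: Ct; rewrite b0 scale0r addr0 gt_eqF.
have Cb1 := C1 _ _ Cv.
have Cb2 : C (b *: u2) by apply: (C2 b 0); rewrite scale0r addr0.
have Csub c d : C (c *: u1 + d *: u2) -> 0 <= b * c /\ 0 <= b * d.
  move=> Cw; split; first exact: proper_cone_ray pC u20 Cb2 (C2 _ _ Cw).
  exact: proper_cone_ray pC u10 Cb1 (C1 _ _ Cw).
have Csup c d : 0 <= b * c -> 0 <= b * d -> C (c *: u1 + d *: u2).
  move=> bc bd; have b2 : 0 < b ^+ 2 by rewrite exprn_even_gt0.
  have e y u : y *: u = (b * y / b ^+ 2) *: (b *: u) :> 'cV[R]_2.
    by rewrite scalerA; congr (_ *: _); field.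
  by rewrite [c *: _]e [d *: _]e; apply: add; apply: cone => //;
    rewrite divr_ge0 // ltW.
have [bp|bn] : 0 < b \/ b < 0 by case: (ltgtP b 0) b0; [right|left|].
  left; apply/seteqP; split=> w; have [c [d ->]] := free_comb w fr.
    by move=> /Csub; rewrite !pmulr_rge0 // Cone2_comb.
  by rewrite Cone2_comb // => -[c0 d0]; apply: Csup; rewrite pmulr_rge0.
right; apply/seteqP; split=> w; have [c [d ->]] := free_comb w fr.
  by move=> /Csub; rewrite !nmulr_rge0 // setN_Cone2.
by rewrite setN_Cone2 // => -[c0 d0]; apply: Csup; rewrite nmulr_rge0.
Qed.

(** As [u] is nonzero, the eigenvalue in the definition of association can only be the spectral
    radius. *)
Lemma positively_associated_dominant (R : realType) (B : 'M[R]_2)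
    (u v : 'cV[R]_2) :
  dominant_eigenvector B u -> positively_associated B u v ->
  exists2 x, 0 < x & B *m v = spectral_radius B *: v + x *: u.
Proof.
move=> [_ [u0 Bu]] [l [x [Bu' x0 Bv]]]; exists x => //; rewrite Bv.
move: Bu' => /eqP; rewrite Bu -subr_eq0 -scalerBl scaler_eq0 (negbTE u0) orbF.
by rewrite subr_eq0 => /eqP->.
Qed.

Lemma dominant_spectral_radius_ge0 (R : realType) (B : 'M[R]_2)
    (u : 'cV[R]_2) :
  dominant_eigenvector B u -> 0 <= spectral_radius B.
Proof.
move=> [_ Bu]; apply: le_trans (normr_ge0 (spectral_radius B)) _.
by apply: eigenvalue_le_spectral_radius; apply/eigenvalue_eigenvector; exists u.
Qed.

Lemma invariant_proper_cone (R : realType) (B1 B2 : 'M[R]_2)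
    (u1 u2 : 'cV[R]_2) (C : set 'cV[R]_2) :
  free [:: u1; u2] ->
  dominant_eigenvector B1 u1 -> dominant_eigenvector B2 u2 ->
  positively_associated B1 u1 u2 -> positively_associated B2 u2 u1 ->
  proper_cone C -> mx_invariant B1 C -> mx_invariant B2 C ->
  C = Cone [set u1; u2] \/ C = setN (Cone [set u1; u2]).
Proof.
move=> fr d1 d2 p1 p2 pC i1 i2.
have [x1 x10 B1u2] := positively_associated_dominant d1 p1.
have [x2 x20 B2u1] := positively_associated_dominant d2 p2.
have l1 := dominant_spectral_radius_ge0 d1.
have l2 := dominant_spectral_radius_ge0 d2.
apply: proper_cone_eq_Cone2 => // a b.
  by apply: proper_cone_associated pC i1 l1 x10 _ B1u2; case: d1 => _ [].
by rewrite addrC; apply: proper_cone_associated pC i2 l2 x20 _ B2u1;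
  case: d2 => _ [].
Qed.

(** * Necessity of (a)-(c) *)

(** Trace minus spectral radius is the other root of the characteristic equation, hence an
    eigenvalue. *)
Lemma vandergraft_comb (R : realType) (A : 'M[R]_2) (u1 u2 : 'cV[R]_2)
    (a b c d : R) :
  free [:: u1; u2] ->
  A *m u1 = a *: u1 + c *: u2 -> A *m u2 = b *: u1 + d *: u2 ->
  vandergraft A ->
  [/\ 0 <= spectral_radius A,
      (a - spectral_radius A) * (d - spectral_radius A) = b * c &
      `|a + d - spectral_radius A| <= spectral_radius A].
Proof.
move=> fr A1 A2 /vandergraft_spectral_radius[].
rewrite (eigenvalue_comb _ fr A1 A2) => e r0 rmax; split=> //.
by apply: rmax; rewrite (eigenvalue_comb _ fr A1 A2) -e; ring.
Qed.

(** If the coordinates had opposite signs, the eigenvector equations would equate non-negative with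
    non-positive quantities. All of these then vanish and [A] is scalar. *)
Lemma invariant_dominant (R : realType) (A : 'M[R]_2) (u1 u2 v : 'cV[R]_2) :
  free [:: u1; u2] -> vandergraft A -> mx_invariant A (Cone [set u1; u2]) ->
  dominant_eigenvector A v ->
  (Cone [set u1; u2] `|` setN (Cone [set u1; u2])) v.
Proof.
move=> fr vA inv [nsc ev].
have [a [c A1]] := free_comb (A *m u1) fr.
have [b [d A2]] := free_comb (A *m u2) fr.
have [x [y vE]] := free_comb v fr; subst v.
have [a0 b0 c0 d0] := (Cone2_invariant fr A1 A2).1 inv.
have [r0 re] := vandergraft_comb fr A1 A2 vA.
set r := spectral_radius A in ev r0 re *; rewrite ler_norml => /andP[_ rmax].
have /(eigenvector_comb _ _ _ fr A1 A2)[_ e1 e2] := ev.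
apply/(double_Cone2 _ _ fr); rewrite leNgt; apply: contra nsc => xy.
have [x0 y0] : x != 0 /\ y != 0.
  by split; apply: contraTneq xy => ->; rewrite ?mulr0 ?mul0r ltxx.
(* [a - r] and [d - r] have a non-negative product and a non-positive sum. *)
have ar : a <= r by have := mulr_ge0 b0 c0; rewrite -re; nra.
have dr : d <= r by have := mulr_ge0 b0 c0; rewrite -re; nra.
apply/(scalar_comb fr A1 A2).
have e1x : (r - a) * x ^+ 2 = b * (x * y)
  by rewrite mulrBl expr2 [r * _]mulrA -e1; ring.
have e2y : (r - d) * y ^+ 2 = c * (x * y)
  by rewrite mulrBl expr2 [r * _]mulrA -e2; ring.
have x2 : 0 < x ^+ 2 by rewrite exprn_even_gt0.
have y2 : 0 < y ^+ 2 by rewrite exprn_even_gt0.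
have b00 : b = 0 by nra.
have c00 : c = 0 by nra.
split=> //.
have : (r - a) * x ^+ 2 = 0 by rewrite e1x b00 mul0r.
have : (r - d) * y ^+ 2 = 0 by rewrite e2y c00 mul0r.
move=> /eqP; rewrite mulf_eq0 (gt_eqF y2) orbF => /eqP rd.
move=> /eqP; rewrite mulf_eq0 (gt_eqF x2) orbF => /eqP ra.
by lra.
Qed.

(** Coordinates of equal strict sign force [a <= l] and [d <= l]. The other root [a + d - l] is then
    at most [l], so [l] is the spectral radius. *)
Lemma invariant_nondominant (R : realType) (A : 'M[R]_2) (u1 u2 v : 'cV[R]_2) :
  free [:: u1; u2] -> vandergraft A -> mx_invariant A (Cone [set u1; u2]) ->
  nondominant_eigenvector A v ->
  ~ interior (Cone [set u1; u2] `|` setN (Cone [set u1; u2])) v.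
Proof.
move=> fr vA inv [_ [l /eqP lr ev]].
have [a [c A1]] := free_comb (A *m u1) fr.
have [b [d A2]] := free_comb (A *m u2) fr.
have [x [y vE]] := free_comb v fr; subst v.
have [a0 b0 c0 d0] := (Cone2_invariant fr A1 A2).1 inv.
have [r0 re rmax] := vandergraft_comb fr A1 A2 vA.
have /(eigenvector_comb _ _ _ fr A1 A2)[_ e1 e2] := ev.
move=> /(interior_double_Cone2 _ _ fr) xy; apply: lr.
have evl : eigenvalue A l by apply/eigenvalue_eigenvector;
  exists (x *: u1 + y *: u2).
have le := (eigenvalue_comb l fr A1 A2).1 evl.
have := eigenvalue_le_spectral_radius evl.
set r := spectral_radius A in r0 re rmax *; rewrite ler_norml => /andP[_ lr].
have al : a <= l.
  have : (l - a) * x ^+ 2 = b * (x * y)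
    by rewrite mulrBl expr2 [l * _]mulrA -e1; ring.
  have x2 : 0 < x ^+ 2 by rewrite exprn_even_gt0 //;
    apply: contraTneq xy => ->; rewrite mul0r ltxx.
  have := mulr_ge0 b0 (ltW xy); nra.
have dl : d <= l.
  have : (l - d) * y ^+ 2 = c * (x * y)
    by rewrite mulrBl expr2 [l * _]mulrA -e2; ring.
  have y2 : 0 < y ^+ 2 by rewrite exprn_even_gt0 //;
    apply: contraTneq xy => ->; rewrite mulr0 ltxx.
  have := mulr_ge0 c0 (ltW xy); nra.
have : (r - l) * (r - (a + d - l)) = 0 by rewrite -(subrr (b * c)) -{1}re -le;
  ring.
by move=> /eqP; rewrite mulf_eq0 => /orP[]/eqP; lra.
Qed.

(** [M] maps [a *: u1 + b *: u2] to [l] times itself plus [(x * b) *: u1]. The resulting half-plane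
    does not depend on [M], so any two such matrices have the same orientation. *)
Lemma associated_set (R : realType) (M : 'M[R]_2) (u1 u2 : 'cV[R]_2) (l x : R) :
  free [:: u1; u2] -> 0 < x -> M *m u1 = l *: u1 -> M *m u2 = l *: u2 + x *: u1
    ->
  [set v | positively_associated M u1 v] =
  [set v | exists a b, 0 < b /\ v = a *: u1 + b *: u2].
Proof.
move=> fr x0 M1 M2; have u10 : u1 != 0.
  by have := comb_eq0 1 0 fr; rewrite scale0r scale1r addr0 oner_eq0 => ->.
have M1' : M *m u1 = l *: u1 + 0 *: u2 by rewrite scale0r addr0.
have M2' : M *m u2 = x *: u1 + l *: u2 by rewrite addrC.
apply/seteqP; split=> v /=; have [a [b ->]] := free_comb v fr; last first.
  move=> [a' [b' [b'0 e]]]; have [_ bE] := comb_inj fr e; rewrite -bE in b'0.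
  exists l, (x * b); split=> //; first exact: mulr_gt0.
  rewrite (mulmx_comb _ _ M1' M2') scalerDr !scalerA addrAC -scalerDl mul0r
    add0r.
  by [].
move=> [l' [y [M1'' y0]]].
have -> : l' = l.
  move: M1'' => /eqP; rewrite M1 -subr_eq0 -scalerBl scaler_eq0 (negbTE u10)
    orbF.
  by rewrite subr_eq0 => /eqP->.
rewrite (mulmx_comb _ _ M1' M2') scalerDr !scalerA addrAC -scalerDl.
move=> /(comb_inj fr)[e _]; exists a, b; split=> //.
have : x * b = y by lra.
by move=> xb; rewrite -(pmulr_rgt0 _ x0) xb.
Qed.

Lemma nondiagonalizable_not_scalar (F : fieldType) (n : nat) (A : 'M[F]_n) :
  ~ diagonalizable A -> ~~ is_scalar_mx A.
Proof. by move=> nd; apply/negP => /is_scalar_mxP[k Ak]; apply: nd;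
  rewrite Ak; exact: diagonalizable_scalar. Qed.

(** [A] is triangular with equal diagonal entries, distinct ones making it diagonalizable. Its entry
    [b] is non-negative by invariance and nonzero because [A] is not scalar. *)
Lemma invariant_same_orientation (R : realType) (A B : 'M[R]_2)
    (u1 u2 : 'cV[R]_2) :
  free [:: u1; u2] -> vandergraft A -> mx_invariant A (Cone [set u1; u2]) ->
  dominant_eigenvector B u1 -> positively_associated B u1 u2 ->
  ~ diagonalizable A -> dominant_eigenvector A u1 -> same_orientation u1 A B.
Proof.
move=> fr vA inv dB pB nd [nsc [_ Au1]].
have [x x0 B2] := positively_associated_dominant dB pB.
have [_ [_ B1]] := dB.
have [b [d A2]] := free_comb (A *m u2) fr.
have A1 : A *m u1 = spectral_radius A *: u1 + 0 *: u2 by rewrite scale0r addr0.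
have [_ b0 _ d0] := (Cone2_invariant fr A1 A2).1 inv.
have dr : d = spectral_radius A.
  apply/eqP/negPn/negP => dr; apply: nd.
  apply: (@diagonalizable_uniq_eigenvalues _ _ _ [:: d;
    spectral_radius A]) => //=.
    by rewrite inE dr.
  rewrite andbT; apply/andP; split; apply/(eigenvalue_comb _ fr A1 A2); ring.
rewrite /same_orientation (associated_set fr x0 B1 B2).
apply: (associated_set fr _ Au1 (x := b)); last by rewrite A2 dr addrC.
rewrite lt_def b0 andbT; apply: contra nsc => /eqP b00.
exact/(scalar_comb fr A1 A2).
Qed.

Lemma free_pair_eq0 (R : realType) (v w : 'cV[R]_2) :
  w != 0 -> ~~ free [:: v; w] <-> exists k, v = k *: w.
Proof.
move=> w0; rewrite free_cons seq1_free w0 andbT negbK span_seq1.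
by split=> [/vlineP|vw]; last exact/vlineP.
Qed.

Lemma invariant_negative_eigenvalue (R : realType) (A : 'M[R]_2)
    (u1 u2 : 'cV[R]_2) (l1 l2 : R) :
  free [:: u1; u2] -> vandergraft A -> mx_invariant A (Cone [set u1; u2]) ->
  eigenvalue A l1 -> eigenvalue A l2 -> 0 < l1 -> l2 < 0 ->
  exists xi eta : R,
    [/\ dominant_eigenvector A (u1 + xi *: u2),
        Cone [set u1; u2] (u1 + xi *: u2),
        forall w, nondominant_eigenvector A w -> ~~ free [:: w; u1 + eta *: u2],
        xi != 0 & l1 / l2 <= eta / xi <= l2 / l1].
Proof.
move=> fr vA inv ev1 ev2 l10 l20.
have [a [c A1]] := free_comb (A *m u1) fr.
have [b [d A2]] := free_comb (A *m u2) fr.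
have [a0 b0 c0 d0] := (Cone2_invariant fr A1 A2).1 inv.
have [r0 re _] := vandergraft_comb fr A1 A2 vA.
have evE l := eigenvalue_comb l fr A1 A2.
move: ev1 ev2; rewrite !evE => e1 e2.
have tr : a + d = l1 + l2.
  have : (l1 - l2) * (l1 + l2 - a - d) = 0
    by rewrite -(subrr (b * c)) -{1}e1 -e2; ring.
  by move=> /eqP; rewrite mulf_eq0 => /orP[]/eqP; lra.
have roots l : (a - l) * (d - l) = b * c -> l = l1 \/ l = l2.
  move=> el; have : (l - l1) * (l - l2) = 0.
    have -> : l2 = a + d - l1 by lra.
    by rewrite -(subrr (b * c)) -{1}el -e1; ring.
  by move=> /eqP; rewrite mulf_eq0 !subr_eq0 => /orP[]/eqP; [left|right].
have rE : spectral_radius A = l1 by case: (roots _ re) => //; lra.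
have al1 : 0 < l1 - a by lra.
(* Both factors of [(a - l2) * (d - l2)] are positive. *)
have bc : 0 < b * c by rewrite -e2 mulr_gt0 //; lra.
have b1 : b != 0 by apply: contraTneq bc => ->; rewrite mul0r ltxx.
have bp : 0 < b by rewrite lt_def b1.
have nsc : ~~ is_scalar_mx A.
  by apply: contra b1 => /(scalar_comb fr A1 A2)[->].
(* The first row of [A - l] gives the eigenvector [u1 + ((l - a) / b) *: u2]. *)
exists ((l1 - a) / b), ((l2 - a) / b); split.
- split=> //; rewrite rE -[X in X + _]scale1r.
  apply/(eigenvector_comb _ _ _ fr A1 A2); rewrite oner_eq0; split=> //.
    by field.
  have -> : c = (a - l1) * (d - l1) / b by rewrite e1 [b * c]mulrC mulfK.
  by field.
- by rewrite -[X in X + _]scale1r; apply/Cone2_comb => //;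
  rewrite ler01 ltW ?divr_gt0.
- move=> w [_ [l lr ew]]; rewrite free_pair_eq0; last first.
    by rewrite -[X in X + _]scale1r comb_eq0 // oner_eq0.
  have [x [y wE]] := free_comb w fr; exists x; rewrite wE scalerDr scalerA.
  have l2E : l = l2.
    have : eigenvalue A l by apply/eigenvalue_eigenvector; exists w.
    by rewrite evE => /roots[] // lE; rewrite lE rE eqxx in lr.
  move: ew; rewrite wE l2E => /(eigenvector_comb _ _ _ fr A1 A2)[_ ex _].
  congr (_ + _ *: _); apply: (mulfI b1).
  have -> : b * y = (l2 - a) * x by lra.
  by field.
- by rewrite mulf_neq0 ?invr_eq0 // gt_eqF.
- have -> : (l2 - a) / b / ((l1 - a) / b) = (l2 - a) / (l1 - a).
    by field; rewrite b1 gt_eqF.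
  (* After clearing denominators the lower bound amounts to [0 <= d] and the upper one to
     [0 <= a]. *)
  rewrite ler_ndivrMr // ler_pdivlMr // mulrAC [_ / _ * l1]mulrAC.
  rewrite !ler_pdivrMr //; apply/andP; split; nra.
Qed.

(** * Sufficiency of (a)-(c) *)

(** Cramer's rule expresses the entries through [r], [m] and the eigenvector coordinates. Their
    signs follow from [0 <= p1 * p2] and [q1 * q2 <= 0]. *)
Lemma nonneg_eigenvalues_invariant (R : realType) (A : 'M[R]_2)
    (u1 u2 v w : 'cV[R]_2) (r m : R) :
  free [:: u1; u2] -> 0 <= m < r -> eigenvector A r v -> eigenvector A m w ->
  (Cone [set u1; u2] `|` setN (Cone [set u1; u2])) v ->
  ~ interior (Cone [set u1; u2] `|` setN (Cone [set u1; u2])) w ->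
  mx_invariant A (Cone [set u1; u2]).
Proof.
move=> fr /andP[m0 mr].
have [a [c A1]] := free_comb (A *m u1) fr.
have [b [d A2]] := free_comb (A *m u2) fr.
have [p1 [p2 ->]] := free_comb v fr; have [q1 [q2 ->]] := free_comb w fr.
move=> /(eigenvector_comb _ _ _ fr A1 A2)[p0 ep1 ep2].
move=> /(eigenvector_comb _ _ _ fr A1 A2)[q0 eq1 eq2].
rewrite (double_Cone2 _ _ fr) (interior_double_Cone2 _ _ fr) => pp.
move=> /negP; rewrite -leNgt => qq.
(* Each entry is multiplied
  by [D ^+ 2] because the sign of the determinant [D] of
   the eigenvectors is not known. *)
pose D := p1 * q2 - p2 * q1.
have aD : a * D = r * (p1 * q2) - m * (p2 * q1).
  transitivity ((a * p1 + b * p2) * q2 - (a * q1 + b * q2) * p2);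
    first by rewrite /D; ring.
  by rewrite ep1 eq1; ring.
have bD : b * D = (m - r) * (p1 * q1).
  transitivity ((a * q1 + b * q2) * p1 - (a * p1 + b * p2) * q1);
    first by rewrite /D; ring.
  by rewrite ep1 eq1; ring.
have cD : c * D = (r - m) * (p2 * q2).
  transitivity ((c * p1 + d * p2) * q2 - (c * q1 + d * q2) * p2);
    first by rewrite /D; ring.
  by rewrite ep2 eq2; ring.
have dD : d * D = m * (p1 * q2) - r * (p2 * q1).
  transitivity ((c * q1 + d * q2) * p1 - (c * p1 + d * p2) * q1);
    first by rewrite /D; ring.
  by rewrite ep2 eq2; ring.
have D0 : D != 0.
  (* If [D = 0], the identities above make every product of a [p] and a [q] vanish, so one
     eigenvector is zero. *)
  apply/eqP => D0; have rm : r - m != 0 by rewrite gt_eqF ?subr_gt0.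
  have pq : p1 * q2 = p2 * q1 by apply/eqP; rewrite -subr_eq0; exact/eqP.
  move: aD bD cD; rewrite D0 !mulr0 -pq -mulrBl => /esym/eqP + /esym/eqP +
    /esym/eqP.
  rewrite -[m - r]opprB mulNr oppr_eq0 !mulf_eq0 (negbTE rm) /= => h1 h2 h3.
  have h4 : (p2 == 0) || (q1 == 0) by rewrite -mulf_eq0 -pq mulf_eq0.
  case/orP: p0 => p0; move: h1 h2 h3 h4; rewrite (negbTE p0) /=.
    by move=> /eqP q20 /eqP q10 _ _; rewrite q20 q10 eqxx in q0.
  by move=> _ _ /eqP q20 /eqP q10; rewrite q20 q10 eqxx in q0.
have D2 : 0 < D ^+ 2 by rewrite exprn_even_gt0.
have sgn x : 0 <= x * D * D -> 0 <= x by rewrite -mulrA -expr2 pmulr_lge0.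
have ppqq : p1 * p2 * (q1 * q2) <= 0 by rewrite mulr_ge0_le0.
have s1 := mulr_ge0 pp (sqr_ge0 q1); have s2 := mulr_ge0 pp (sqr_ge0 q2).
have s3 := mulr_ge0_le0 (sqr_ge0 p1) qq;
  have s4 := mulr_ge0_le0 (sqr_ge0 p2) qq.
have t1 := sqr_ge0 (p1 * q2); have t2 := sqr_ge0 (p2 * q1).
have rm : 0 <= r - m by rewrite subr_ge0 ltW.
have r0 : 0 <= r by rewrite (le_trans m0) ?ltW.
have rs : 0 <= r + m by rewrite addr_ge0.
apply/(Cone2_invariant fr A1 A2); split; apply: sgn.
- rewrite aD (_ : _ * D = r * (p1 * q2) ^+ 2 + m * (p2 * q1) ^+ 2
      + (r + m) * - (p1 * p2 * (q1 * q2))); last by rewrite /D; ring.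
  by rewrite !addr_ge0 // mulr_ge0 // oppr_ge0.
- rewrite bD (_ : _ * D = (r - m) * (p1 * p2 * q1 ^+ 2 - p1 ^+ 2 * (q1 * q2)));
    last by rewrite /D; ring.
  by rewrite mulr_ge0 // addr_ge0 // oppr_ge0.
- rewrite cD (_ : _ * D = (r - m) * (p1 * p2 * q2 ^+ 2 - p2 ^+ 2 * (q1 * q2)));
    last by rewrite /D; ring.
  by rewrite mulr_ge0 // addr_ge0 // oppr_ge0.
- rewrite dD (_ : _ * D = m * (p1 * q2) ^+ 2 + r * (p2 * q1) ^+ 2
      + (r + m) * - (p1 * p2 * (q1 * q2))); last by rewrite /D; ring.
  by rewrite !addr_ge0 // mulr_ge0 // oppr_ge0.
Qed.

(** With [t = eta / xi < 0], each entry times [1 - t] is explicit. The two bounds on [t] give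
    [0 <= a] and [0 <= d]; the signs of [b] and [c] come from [m < r], [0 < xi] and [t < 0]. *)
Lemma negative_eigenvalue_invariant (R : realType) (A : 'M[R]_2)
    (u1 u2 w : 'cV[R]_2) (r m xi eta : R) :
  free [:: u1; u2] -> 0 < r -> m < 0 ->
  eigenvector A r (u1 + xi *: u2) -> eigenvector A m w ->
  ~~ free [:: w; u1 + eta *: u2] -> 0 < xi -> r / m <= eta / xi <= m / r ->
  mx_invariant A (Cone [set u1; u2]).
Proof.
move=> fr r0 m0.
have [a [c A1]] := free_comb (A *m u1) fr.
have [b [d A2]] := free_comb (A *m u2) fr.
rewrite -[X in eigenvector A r (X + _)]scale1r.
move=> /(eigenvector_comb _ _ _ fr A1 A2)[_ ep1 ep2] ew.
rewrite free_pair_eq0; last first.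
  by rewrite -[X in X + _]scale1r comb_eq0 // oner_eq0.
move=> [k wE]; move: ew; rewrite wE scalerDr scalerA.
move=> /(eigenvector_comb _ _ _ fr A1 A2)[k0 ek1 ek2] xi0.
have {}k0 : k != 0 by move: k0; rewrite mulf_eq0; case: eqP.
have eq1 : a + b * eta = m by apply: (mulIf k0); rewrite -ek1; ring.
have eq2 : c + d * eta = m * eta by apply: (mulIf k0);
  rewrite mulrAC -mulrA -ek2; ring.
set t := eta / xi; have etaE : eta = t * xi by rewrite /t divfK ?gt_eqF.
rewrite ler_ndivrMr // ler_pdivlMr // => /andP[tm tr].
have t0 : t < 0 by nra.
have t1 : 0 < 1 - t by lra.
rewrite !mulr1 in ep1 ep2; rewrite etaE in eq1 eq2.
have bE : b * xi * (1 - t) = r - m by rewrite -ep1 -eq1; ring.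
have aE : a * (1 - t) = m - t * r by rewrite -ep1 -eq1; ring.
have dE : d * xi * (1 - t) = (r - t * m) * xi.
  transitivity ((c + d * xi) - (c + d * (t * xi))); first by ring.
  by rewrite ep2 eq2; ring.
have cE : c * (1 - t) = - t * xi * (r - m).
  transitivity ((c + d * (t * xi)) - t * (c + d * xi)); first by ring.
  by rewrite ep2 eq2; ring.
apply/(Cone2_invariant fr A1 A2); split.
- by rewrite -(pmulr_lge0 _ t1) aE subr_ge0.
- by rewrite -(pmulr_lge0 _ xi0) -(pmulr_lge0 _ t1) bE; lra.
- by rewrite -(pmulr_lge0 _ t1) cE !mulr_ge0 //; lra.
- by rewrite -(pmulr_lge0 _ xi0) -(pmulr_lge0 _ t1) dE mulr_ge0 ?subr_ge0 //
  ltW.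
Qed.

Lemma mx_invariant_setN (R : realType) (n : nat) (A : 'M[R]_n)
    (K : set 'cV[R]_n) : mx_invariant A K -> mx_invariant A (setN K).
Proof. by move=> inv _ [x Kx <-]; exists (A *m x);
  [exact: inv|rewrite mulmxN]. Qed.

(** Two distinct elements already use both labels of a bijection onto [{0, 1}]. *)
Lemma card_eq2 (T : Type) (S : set T) (x y z : T) :
  (S #= `I_2)%card -> S x -> S y -> S z -> x <> y -> z = x \/ z = y.
Proof.
move=> /card_set_bijP[f bf] Sx Sy Sz xy.
have fI w w' : S w -> S w' -> f w = f w' -> w = w'.
  by move=> Sw Sw'; apply: (set_bij_inj bf); rewrite inE.
have [flt _ _] := bf; have fxy : f x <> f y by move=> /fI; auto.
suff : f z = f x \/ f z = f y by case=> /fI; auto.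
move: fxy (flt x Sx) (flt y Sy) (flt z Sz) => /=.
by case: (f x) => [|[|//]]; case: (f y) => [|[|//]]; case: (f z) => [|[|//]];
  auto.
Qed.

Lemma nondiagonalizable_dominant (R : realType) (F : set 'M[R]_2)
    (B1 B2 M : 'M[R]_2) (u1 u2 : 'cV[R]_2) :
  exactly_two_nondiag_eigenlines F -> free [:: u1; u2] ->
  F B1 -> F B2 -> F M ->
  ~ diagonalizable B1 -> ~ diagonalizable B2 -> ~ diagonalizable M ->
  dominant_eigenvector B1 u1 -> dominant_eigenvector B2 u2 ->
  dominant_eigenvector M u1 \/ dominant_eigenvector M u2.
Proof.
move=> two fr F1 F2 FM n1 n2 nM [_ [u10 d1]] [nsc [u20 d2]].
have nscM := nondiagonalizable_not_scalar nM.
have line N : F N -> ~ diagonalizable N ->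
    [set dominant_eigenline M | M in F `&` [set M | ~ diagonalizable M]]
      (dominant_eigenline N).
  by move=> FN nN; exists N.
have line_eq N N' (u : 'cV[R]_2) : dominant_eigenline N' = dominant_eigenline N
  ->
    N *m u = spectral_radius N *: u -> N' *m u = spectral_radius N' *: u.
  by move=> e Nu; have : dominant_eigenline N u by []; rewrite -e.
(* If the lines coincided, [B2] would have both [u1] and [u2] as dominant eigenvectors and would be
   scalar. *)
have l12 : dominant_eigenline B1 <> dominant_eigenline B2.
  move=> /esym/line_eq /(_ d1) d1'; move/negP: nsc; apply.
  apply/(@scalar_comb _ _ u1 u2 (spectral_radius B2) 0 0 (spectral_radius B2)
    fr).
  - by rewrite scale0r addr0.
  - by rewrite scale0r add0r.
  - by [].
have [] := card_eq2 two (line _ F1 n1) (line _ F2 n2) (line _ FM nM) l12.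
  by move=> /line_eq e; left; exact: (conj nscM (conj u10 (e _ d1))).
by move=> /line_eq e; right; exact: (conj nscM (conj u20 (e _ d2))).
Qed.

Lemma invariant_of_eigenvectors (R : realType) (A : 'M[R]_2)
    (u1 u2 : 'cV[R]_2) (K := Cone [set u1; u2]) :
  free [:: u1; u2] -> vandergraft A ->
  (~ diagonalizable A ->
     (dominant_eigenvector A u1 /\ positively_associated A u1 u2) \/
     (dominant_eigenvector A u2 /\ positively_associated A u2 u1)) ->
  (forall v, dominant_eigenvector A v -> (K `|` setN K) v) ->
  (forall v, nondominant_eigenvector A v -> ~ interior (K `|` setN K) v) ->
  (forall l1 l2 : R, eigenvalue A l1 -> eigenvalue A l2 -> 0 < l1 -> l2 < 0 ->
     exists xi eta : R,
       [/\ dominant_eigenvector A (u1 + xi *: u2), K (u1 + xi *: u2),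
           forall w, nondominant_eigenvector A w ->
             ~~ free [:: w; u1 + eta *: u2],
           xi != 0 & l1 / l2 <= eta / xi <= l2 / l1]) ->
  mx_invariant A K.
Proof.
move=> fr vA nondiag dom ndom neg.
have [a [c A1]] := free_comb (A *m u1) fr.
have [b [d A2]] := free_comb (A *m u2) fr.
have [r0 re rmax] := vandergraft_comb fr A1 A2 vA.
have evr : eigenvalue A (spectral_radius A)
  by apply/(eigenvalue_comb _ fr A1 A2).
set r := spectral_radius A in r0 re rmax evr.
(* [m] is the second eigenvalue; the cases are [A] scalar, [m = r], [0 <= m < r] and [m < 0]. *)
pose m := a + d - r.
have evm : eigenvalue A m.
  by apply/(eigenvalue_comb _ fr A1 A2); rewrite -re /m; ring.
have [/(scalar_comb fr A1 A2)[b0 c0 ad]|nsc] := boolP (is_scalar_mx A).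
  apply/(Cone2_invariant fr A1 A2); rewrite b0 c0 -ad.
  suff -> : a = r by [].
  by move: re; rewrite b0 mul0r -ad => /eqP;
    rewrite mulf_eq0 orbb subr_eq0 => /eqP.
have := rmax; rewrite ler_norml -/m => /andP[_].
rewrite le_eqVlt => /predU1P[mr|mr].
  (* A diagonalizable matrix with [r] as its only eigenvalue would be scalar. *)
  have nd : ~ diagonalizable A.
    move=> dA; suff AE : A = r%:M by rewrite AE scalar_mx_is_scalar in nsc.
    apply: diagonalizable_one_eigenvalue => // l /(eigenvalue_comb _ fr A1 A2)
      le.
    have : (l - r) * (l - m) = 0 by rewrite -(subrr (b * c)) -{1}le -re /m;
      ring.
    by rewrite mr => /eqP; rewrite mulf_eq0 orbb subr_eq0 => /eqP.
  case: (nondiag nd) => -[dA /(positively_associated_dominant dA)[x x0 Au]];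
    case: dA => _ [_ Au'].
    have [||_ inv] := @Cone2_invariant _ A u1 u2 r x 0 r fr.
    - by rewrite scale0r addr0.
    - by rewrite addrC.
    - by apply: inv; split=> //; exact: ltW.
  have [||_ inv] := @Cone2_invariant _ A u1 u2 r 0 x r fr.
  - exact: Au.
  - by rewrite scale0r add0r.
  - by apply: inv; split=> //; exact: ltW.
have [v ev] := (eigenvalue_eigenvector A r).1 evr.
have [w ew] := (eigenvalue_eigenvector A m).1 evm.
have nw : nondominant_eigenvector A w by split=> //; exists m; rewrite ?lt_eqF.
have dv : dominant_eigenvector A v by [].
have [m0|m0] := leP 0 m.
  by apply: (nonneg_eigenvalues_invariant fr _ ev ew (dom _ dv) (ndom _ nw));
    rewrite m0.
(* The spectral radius is at least the modulus of [m], which is nonzero. *)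
have rp : 0 < r by have := eigenvalue_le_spectral_radius evm; rewrite -/r;
  apply: lt_le_trans; rewrite normr_gt0 lt_eqF.
have [xi [eta [[_ exi] Kxi /(_ w nw) nf xi0 le]]] := neg _ _ evr evm rp m0.
apply: (negative_eigenvalue_invariant fr rp m0 exi ew nf _ le).
rewrite lt_def xi0; move: Kxi; rewrite -[X in X + _]scale1r.
by move=> /(Cone2_comb _ _ fr)[].
Qed.

Theorem theorem11 (R : realType) (n : nat) (A : 'I_n -> 'M[R]_2)
    (B1 B2 : 'M[R]_2) (u1 u2 : 'cV[R]_2)
    (A_vandergraft : forall j, vandergraft (A j))
    (A1_vandergraft :
       forall M, extended_family (range A) M -> vandergraft M)
    (two_lines : exactly_two_nondiag_eigenlines (extended_family (range A)))
    (oriented : oriented_family (extended_family (range A)))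
    (sep : eigenlines_separated (extended_family (range A)))
    (A1B1 : extended_family (range A) B1)
    (A1B2 : extended_family (range A) B2)
    (ndB1 : ~ diagonalizable B1) (ndB2 : ~ diagonalizable B2)
    (B1u1 : dominant_eigenvector B1 u1) (B2u2 : dominant_eigenvector B2 u2)
    (u1u2_noncollinear : free [:: u1; u2])
    (B1u1u2 : positively_associated B1 u1 u2)
    (B2u2u1 : positively_associated B2 u2 u1) :
  let K := Cone [set u1; u2] in
  (forall C : set 'cV[R]_2, proper_cone C -> family_invariant (range A) C ->
     C = K \/ C = setN K) /\
  ((family_invariant (range A) K /\ family_invariant (range A) (setN K)) <->
   [/\ (* (a) *)
       (forall j, ~ diagonalizable (A j) -> dominant_eigenvector (A j) u1 ->
          same_orientation u1 (A j) B1) /\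
       (forall j, ~ diagonalizable (A j) -> dominant_eigenvector (A j) u2 ->
          same_orientation u2 (A j) B2),
       (* (b) *)
       forall j v,
         (dominant_eigenvector (A j) v -> (K `|` setN K) v) /\
         (nondominant_eigenvector (A j) v -> ~ interior (K `|` setN K) v) &
       (* (c) *)
       forall j (l1 l2 : R), eigenvalue (A j) l1 -> eigenvalue (A j) l2 ->
         0 < l1 -> l2 < 0 ->
         exists xi eta : R,
           [/\ dominant_eigenvector (A j) (u1 + xi *: u2),
               K (u1 + xi *: u2),
               forall w, nondominant_eigenvector (A j) w ->
                 ~~ free [:: w; u1 + eta *: u2],
               xi != 0 & l1 / l2 <= eta / xi <= l2 / l1]]).
Proof.
move=> K; split=> [C pC /extended_family_invariant inv|].
  exact: (invariant_proper_cone u1u2_noncollinear B1u1 B2u2 B1u1u2 B2u2u1 pC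
    (inv _ A1B1) (inv _ A1B2)).
split=> [[invK _]|[[orient1 orient2] eigv neg]].
  have inv j : mx_invariant (A j) K by apply: invK; exists j.
  split=> [|j v|j l1 l2].
  - split=> j; first exact: invariant_same_orientation (inv j) B1u1 B1u1u2.
    (* The cone is symmetric in its generators, so the roles of [u1] and [u2] are exchanged. *)
    apply: (@invariant_same_orientation _ _ _ u2 u1) => //.
      by have /= -> := perm_free (permEl (perm_rcons u1 [:: u2])).
    by rewrite setUC; exact: inv.
  - by split; [exact: invariant_dominant|exact: invariant_nondominant].
  - exact: invariant_negative_eigenvalue.
have inv j : mx_invariant (A j) K.
  apply: invariant_of_eigenvectors => // [nd|v|v|];
    [|exact: (eigv j v).1|exact: (eigv j v).2|exact: neg].
  have FA : extended_family (range A) (A j) by left; exists j.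
  have [dA|dA] := nondiagonalizable_dominant two_lines u1u2_noncollinear A1B1
    A1B2 FA ndB1 ndB2 nd B1u1 B2u2.
    (* By (a), the positive association of [u2] with [u1] carries over from [B1] to [A j]. *)
    left; split=> //; have : [set v | positively_associated B1 u1 v] u2 by [].
    by rewrite -(orient1 j nd dA).
  right; split=> //; have : [set v | positively_associated B2 u2 v] u1 by [].
  by rewrite -(orient2 j nd dA).
by split=> _ [j _ <-]; last apply: mx_invariant_setN; exact: inv.
Qed.
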